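(* For every integer $n\ge 1$, \[ \sum_{p\in\mathcal{D}(n)} q^{\operatorname{area}(p)}t^{\operatorname{rk}(p)} = \sum_{m \in \mathcal{M}(n)} q^{\operatorname{area}(m)}t^{\operatorname{rk}(m)}(1+qt)^{n-1-2\operatorname{rk}(m)}.\]
   Context: A Dyck path of order $n$ is a lattice path from $(0,0)$ to $(2n,0)$ using $n$ up steps $(x,y)\to(x+1,y+1)$ and $n$ down steps $(x,y)\to(x+1,y-1)$ that never goes below the $x$-axis; $\mathcal{D}(n)$ is the set of them. The area $\operatorname{area}(p)$ is the number of points $(x,y)\in\mathbb{Z}^2$ with $x+y$ even and $y\ge0$ lying strictly below $p$ (not on $p$). To $p$ associate the set partition $\phi(p)$ of $\{1,\dots,n\}$ in which $i,i'$ are in the same block iff for some $j$ the points $(2i-1,2j-1)$ and $(2i'-1,2j-1)$ both lie on $p$ and the portion of $p$ between them never goes below $y=2j-1$; set $\operatorname{rk}(p)=n-(\text{number of blocks of }\phi(p))$. A Motzkin path of order $n$ is a path from $(1,1)$ to $(2n-1,1)$ with steps $(2,2)$ (up), $(2,-2)$ (down), $(2,0)$ (horizontal) never going below $y=1$; $\mathcal{M}(n)$ is the set of them (for $n=1$ it is the single empty path). For $m\in\mathcal{M}(n)$ let $\rho(m)\in\mathcal{D}(n)$ be the Dyck path obtained by an initial up step from $(0,0)$ to $(1,1)$, then replacing each up step of $m$ by two up steps, each down step by two down steps, each horizontal step by a down step followed by an up step, and finally a down step to $(2n,0)$. Define $\operatorname{area}(m)=\operatorname{area}(\rho(m))$ and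 $\operatorname{rk}(m)=\operatorname{rk}(\rho(m))$ (which equals the number of up steps of $m$). *)

(* Defs.v *)
From HB Require Import structures.
From mathcomp Require Import all_boot all_order all_algebra.

Set Implicit Arguments.
Unset Strict Implicit.
Unset Printing Implicit Defensive.

Import Order.TTheory GRing.Theory Num.Theory.

(* A path from (0,0) with unit up/down steps is the sequence of its steps,
   [true] being an up step; [height p x] is its ordinate at abscissa [x]. *)
Definition height (p : seq bool) (x : nat) : int :=
  ((count id (take x p))%:Z - (count negb (take x p))%:Z)%R.

Definition is_dyck (n : nat) (p : seq bool) : bool :=
  [&& count id p == n, count negb p == n
    & [forall x : 'I_(2 * n).+1, (0 <= height p x)%R]].

Definition Dyck (n : nat) : {set (2 * n).-tuple bool} :=
  [set p : (2 * n).-tuple bool | is_dyck n p].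

(* The box [0, 2n] x [0, 2n] contains every lattice point with nonnegative
   ordinate lying below a Dyck path of order n. *)
Definition area (n : nat) (p : seq bool) : nat :=
  #|[set z : 'I_(2 * n).+1 * 'I_(2 * n).+1 |
      ~~ odd (z.1 + z.2) && ((z.2 : nat)%:Z < height p z.1)%R]|.

(* The element i of {1, ..., n} is represented by i - 1 : 'I_n, so the abscissa
   2i - 1 becomes 2i + 1. The heights of a Dyck path of order n are at most n,
   hence the bound on j is no restriction. *)
Definition same_block (n : nat) (p : seq bool) : rel 'I_n := fun i i' =>
  [exists j : 'I_n.+1,
    [&& height p (2 * i).+1 == (2 * (j : nat)%:Z - 1)%R,
        height p (2 * i').+1 == (2 * (j : nat)%:Z - 1)%R
      & [forall x : 'I_(2 * n).+1,
          (minn (2 * i).+1 (2 * i').+1 <= x <= maxn (2 * i).+1 (2 * i').+1) ==>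
          (2 * (j : nat)%:Z - 1 <= height p x)%R]]].

Definition phi (n : nat) (p : seq bool) : {set {set 'I_n}} :=
  equivalence_partition (@same_block n p) [set: 'I_n].

Definition rk (n : nat) (p : seq bool) : nat := n - #|phi n p|.

Inductive mstep := MUp | MDown | MHor.

Definition mstep_encode (s : mstep) : option bool :=
  match s with MUp => Some true | MDown => Some false | MHor => None end.

Definition mstep_decode (o : option bool) : mstep :=
  match o with Some true => MUp | Some false => MDown | None => MHor end.

Lemma mstep_encodeK : cancel mstep_encode mstep_decode.
Proof. by case. Qed.

HB.instance Definition _ := Finite.copy mstep (can_type mstep_encodeK).

(* The ordinate after k steps of a path starting at (1,1). *)
Definition mheight (m : seq mstep) (k : nat) : int :=
  (1 + 2 * (count_mem MUp (take k m))%:Z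
     - 2 * (count_mem MDown (take k m))%:Z)%R.

Definition is_motzkin (m : seq mstep) : bool :=
  (mheight m (size m) == 1%R)
  && [forall k : 'I_(size m).+1, (1 <= mheight m k)%R].

(* Each step advances the abscissa by 2, so there are n - 1 of them. *)
Definition Motzkin (n : nat) : {set n.-1.-tuple mstep} :=
  [set m : n.-1.-tuple mstep | is_motzkin m].

Definition expand_step (s : mstep) : seq bool :=
  match s with
  | MUp => [:: true; true]
  | MDown => [:: false; false]
  | MHor => [:: false; true]
  end.

Definition rho (m : seq mstep) : seq bool :=
  true :: flatten (map expand_step m) ++ [:: false].

Definition marea (n : nat) (m : seq mstep) : nat := area n (rho m).

(* On Motzkin n this is the number of up steps, hence 2 * mrk n m <= n - 1 and
   the truncated difference n - 1 - 2 * mrk n m is the integer one. *)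
Definition mrk (n : nat) (m : seq mstep) : nat := rk n (rho m).

(* Main.v *)
(* A Dyck path of order n is an up step, then n - 1 pairs of steps, then a down
   step; reading the pairs UU, DD and UD/DU as up, down and horizontal makes it a
   Motzkin path with two-coloured horizontal steps. Turning DU into UD raises one
   even-abscissa height by 2, which adds one point to the area. Each block of
   phi(p) has exactly one element i followed by a down step (its maximum), so
   rk(p) counts the pairs starting with U. Hence each horizontal step
   contributes a factor 1 + qt, and a Motzkin path with r up steps has
   n - 1 - 2r of them. *)
Require Import Defs.
From HB Require Import structures.
From mathcomp Require Import all_boot all_order all_algebra.
From mathcomp Require Import zify.

Set Implicit Arguments.
Unset Strict Implicit.
Unset Printing Implicit Defensive.

Import Order.TTheory GRing.Theory Num.Theory.
Local Open Scope ring_scope.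

(** * Heights of step sequences *)

Definition sgn (b : bool) : int := if b then 1 else -1.

Lemma height0 p : height p 0 = 0.
Proof. by rewrite /height take0. Qed.

Lemma height_cons b p x : height (b :: p) x.+1 = sgn b + height p x.
Proof. by rewrite /height /sgn; case: b => /=; lia. Qed.

(** Shows that height and abscissa have the same parity, which is how all parity arguments below
    obtain it. *)
Lemma height_count p x : (x <= size p)%N ->
  height p x = 2 * (count id (take x p))%:Z - x%:Z.
Proof.
move=> xp; have := count_predC id (take x p).
by rewrite size_takel // /height; rewrite -[count (predC _) _]/(count negb _); lia.
Qed.

Lemma heightS p x : (x < size p)%N ->
  height p x.+1 = height p x + sgn (nth false p x).
Proof.
move=> xp; rewrite /height (take_nth false) // -cats1 !count_cat /= /sgn.
by case: (nth _ _ _) => /=; lia.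
Qed.

(** * Blocks of the set partition and the rank *)

Section Blocks.

Variables (n : nat) (p : seq bool).
Hypotheses (size_p : size p = (2 * n)%N) (dyck_p : is_dyck n p).

Lemma dyck_height_ge0 x : (x <= 2 * n)%N -> 0 <= height p x.
Proof.
move=> xn; case/and3P: dyck_p => _ _ /forallP/(_ (inord x)).
by rewrite inordK // ltnS.
Qed.

Lemma dyck_height_end : height p (2 * n) = 0.
Proof.
case/and3P: dyck_p => /eqP pu /eqP pd _.
by rewrite /height -size_p take_size pu pd; lia.
Qed.

Lemma dyck_height_le x : (x <= 2 * n)%N -> height p x <= n%:Z.
Proof.
move=> xn; case/and3P: dyck_p => /eqP pu _ _.
rewrite /height; have := count_cat id (take x p) (drop x p).
by rewrite cat_take_drop pu; lia.
Qed.

(** The level 2j - 1 is the height at [i], so [j] can be eliminated. Conversely, this height is odd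
    and lies between 0 and n, so it yields an admissible [j]. *)
Lemma same_blockP (i i' : 'I_n) :
  reflect (height p (2 * i).+1 = height p (2 * i').+1 /\
           forall x, (minn (2 * i).+1 (2 * i').+1 <= x <= maxn (2 * i).+1 (2 * i').+1)%N ->
             height p (2 * i).+1 <= height p x)
          (@same_block n p i i').
Proof.
have ltin := ltn_ord i; have lti'n := ltn_ord i'.
apply: (iffP existsP) => [[j /and3P[/eqP hi /eqP hi' /forallP H]]|[hii' H]].
  rewrite hi hi'; split=> // x xb.
  have xn : (x < (2 * n).+1)%N by lia.
  by have /implyP := H (Ordinal xn); apply.
have xi : ((2 * i).+1 <= 2 * n)%N by lia.
have hle := dyck_height_le xi; have hge := dyck_height_ge0 xi.
have hc : height p (2 * i).+1 = 2 * (count id (take (2 * i).+1 p))%:Z - (2 * i).+1%:Z.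
  by apply: height_count; rewrite size_p.
(* With u up steps among the first 2i + 1, the height is 2u - (2i + 1) = 2(u - i) - 1, and u > i
   since it is nonnegative. *)
pose k := (count id (take (2 * i).+1 p) - i)%N.
have hk : height p (2 * i).+1 = 2 * k%:Z - 1 by rewrite /k; lia.
have kn : (k < n.+1)%N by lia.
exists (Ordinal kn); rewrite /= -hii' hk eqxx /=.
by apply/forallP => x; apply/implyP => /H; rewrite hk.
Qed.

Lemma same_block_equiv : {in [set: 'I_n] & &, equivalence_rel (@same_block n p)}.
Proof.
have refl (i : 'I_n) : same_block p i i.
  by apply/same_blockP; split=> // x xb; have -> : x = (2 * i).+1 by lia.
have sym (i i' : 'I_n) : same_block p i i' -> same_block p i' i.
  move=> /same_blockP[e H]; apply/same_blockP; split=> // x xb.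
  by rewrite -e; apply: H; lia.
have trans (i' i i'' : 'I_n) : same_block p i i' -> same_block p i' i'' -> same_block p i i''.
  move=> /same_blockP[e1 H1] /same_blockP[e2 H2]; apply/same_blockP.
  split=> [|x xb]; first by rewrite e1.
  (* The span of [i] and [i''] is covered by those of [i], [i'] and of [i'], [i'']. *)
  have [xb'|xb'] := boolP (minn (2 * i).+1 (2 * i').+1 <= x <= maxn (2 * i).+1 (2 * i').+1)%N.
    exact: H1.
  by rewrite e1; apply: H2; lia.
move=> i i' i'' _ _ _; split=> // ii'.
by apply/idP/idP; apply: trans => //; apply: sym.
Qed.

(* A down step leaving i takes the path below its block, so i is its maximum. *)
Lemma down_step_block_max (i i' : 'I_n) :
  same_block p i i' -> ~~ nth false p (2 * i).+1 -> (i' <= i)%N.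
Proof.
move=> /same_blockP[e H] Di; rewrite leqNgt; apply/negP => lt.
have lti'n := ltn_ord i'.
have := H (2 * i).+2; rewrite (@heightS p (2 * i).+1) ?size_p; last by lia.
by rewrite (negbTE Di) /sgn; lia.
Qed.

(** Follow the path from 2i + 1 to the first point below that level: the step reaching it is a down
    step leaving a point of the same block. *)
Lemma block_has_down_step (i : 'I_n) :
  exists2 i' : 'I_n, same_block p i i' & ~~ nth false p (2 * i').+1.
Proof.
have ltin := ltn_ord i.
pose P x := ((2 * i).+1 < x <= 2 * n)%N && (height p x < height p (2 * i).+1).
have exP : exists x, P x.
  (* The path ends at height 0, while the height at the odd abscissa 2i + 1 is odd, hence
     positive. *)
  exists (2 * n)%N; rewrite /P dyck_height_end.
  have xi : ((2 * i).+1 <= 2 * n)%N by lia.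
  have hge := dyck_height_ge0 xi.
  by rewrite height_count ?size_p // in hge *; lia.
case: (ex_minnP exP) => -[|x] /andP[/andP[lo hi] hx] minx; first by lia.
have ge y : ((2 * i).+1 <= y <= x)%N -> height p (2 * i).+1 <= height p y.
  move=> yb; have [->|ny] := eqVneq y (2 * i).+1; first by [].
  rewrite leNgt; apply/negP => ly.
  by have := minx y; rewrite /P ly; lia.
have hgex : height p (2 * i).+1 <= height p x by apply: ge; lia.
have := hx; rewrite (@heightS p x) ?size_p // /sgn.
case Ex: (nth false p x) => hx'; first by lia.
have exi : height p x = height p (2 * i).+1 by lia.
(* Equal heights force abscissas of equal parity, so x is odd. *)
have par : (x = (2 * x./2).+1)%N.
  move: exi; rewrite !height_count ?size_p; [|lia|lia] => exi.
  by have := odd_double_half x; lia.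
have ltx : (x./2 < n)%N by lia.
exists (Ordinal ltx); rewrite /= -?par ?Ex //.
apply/same_blockP; rewrite /= -par; split=> // y yb.
by apply: ge; lia.
Qed.

(** The elements followed by a down step form a transversal of the blocks, so the rank counts the
    remaining ones. *)
Lemma rk_count : rk n p = #|[set i : 'I_n | nth false p (2 * i).+1]|.
Proof.
pose X := [set i : 'I_n | ~~ nth false p (2 * i).+1].
have part := equivalence_partitionP same_block_equiv.
suff /card_transversal eX : is_transversal X (phi n p) [set: 'I_n].
  rewrite /rk -eX /X; have := cardsC [set i : 'I_n | nth false p (2 * i).+1].
  have -> : ~: [set i : 'I_n | nth false p (2 * i).+1] = X.
    by apply/setP => i; rewrite !inE.
  by rewrite card_ord => /(congr1 (fun k => k - #|X|)%N); rewrite addnK.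
rewrite /is_transversal part subsetT /=.
apply/forall_inP => _ /imsetP[i _ ->].
have [i' ii' Di'] := block_has_down_step i.
apply/cards1P; exists i'; apply/setP => k; rewrite !inE.
apply/andP/eqP => [[Dk ik]|->]; last by [].
have [_ /(_ ii') eik] := same_block_equiv (in_setT i) (in_setT i') (in_setT k).
have [_ /(_ ik) eii'] := same_block_equiv (in_setT i) (in_setT k) (in_setT i').
(* Both [k] and [i'] are maxima of one block, so each bounds the other. *)
apply/val_inj/eqP; rewrite eqn_leq (down_step_block_max _ Di') -?eik //.
by rewrite (down_step_block_max _ Dk) -?eii'.
Qed.

End Blocks.

(** * Cutting a path into pairs of steps *)

Definition mproj (ab : bool * bool) : mstep :=
  match ab with
  | (true, true) => MUp
  | (false, false) => MDown
  | _ => MHor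
  end.

(** The lift made by [rho]: a horizontal step becomes DU, its lift of smaller area. *)
Definition mlift (s : mstep) : bool * bool :=
  match s with
  | MUp => (true, true)
  | MDown => (false, false)
  | MHor => (false, true)
  end.

Lemma mliftK : cancel mlift mproj.
Proof. by case. Qed.

Fixpoint unpair (w : seq (bool * bool)) : seq bool :=
  if w is ab :: w' then ab.1 :: ab.2 :: unpair w' else [::].

Fixpoint pairup (s : seq bool) : seq (bool * bool) :=
  if s is a :: b :: s' then (a, b) :: pairup s' else [::].

Definition path_of (w : seq (bool * bool)) : seq bool :=
  true :: unpair w ++ [:: false].

Lemma rhoE m : rho m = path_of (map mlift m).
Proof.
rewrite /rho /path_of; congr (_ :: (_ ++ _)).
by elim: m => //= -[] m ->.
Qed.

Lemma size_unpair w : size (unpair w) = (2 * size w)%N.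
Proof. by elim: w => //= ab w ->; rewrite mulnS. Qed.

Lemma size_path_of w : size (path_of w) = (2 * (size w).+1)%N.
Proof. by rewrite /= size_cat size_unpair /= mulnS addn1. Qed.

Lemma unpairK w s : (size s <= 1)%N -> pairup (unpair w ++ s) = w.
Proof.
elim: w => [|[a b] w IH] /=; first by case: s => [|x []].
by move=> /IH ->.
Qed.

Lemma pairupK k s : size s = (2 * k).+1 ->
  size (pairup s) = k /\ s = unpair (pairup s) ++ [:: last false s].
Proof.
elim: k s => [|k IH] [|a [|b s]] //=.
case=> ss; have [|ps es] := IH s; first by lia.
split; first by rewrite ps.
(* [es] rules out an empty [s], and on a nonempty list [last] is independent of its default. *)
by congr [:: _, _ & _]; case: s {ss IH ps} es => // c s.
Qed.

(** * Area as a sum over the columns *)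

Definition area_from (h : int) (p : seq bool) : nat :=
  (\sum_(x < (size p).+1) (absz (h + height p x)%R)./2)%N.

Lemma area_from_cons h b p :
  area_from h (b :: p) = ((absz h)./2 + area_from (h + sgn b) p)%N.
Proof.
rewrite /area_from big_ord_recl height0 addr0; congr addn.
by apply: eq_bigr => x _; rewrite lift0 height_cons addrA.
Qed.

Lemma card_ord_sum k (P : pred nat) :
  #|[set y : 'I_k | P y]| = (\sum_(y < k) P y)%N.
Proof.
rewrite cardsE -sum1_card big_mkcond /=; apply: eq_bigr => y _.
by rewrite unfold_in; case: (P y).
Qed.

Lemma sum_even_shift x k :
  (\sum_(y < k) ~~ odd (x + y) = if odd x then k./2 else uphalf k)%N.
Proof.
elim: k => [|k IH]; first by rewrite big_ord0 if_same.
by rewrite big_ord_recr IH /= oddD; case: (odd x) => /=; lia.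
Qed.

(** The points of column x have ordinates 0, 2, ... or 1, 3, ... according to the parity of x; as
    [h] shares this parity, half of [h], rounded down, of them lie below it. *)
Lemma card_same_parity_below N x (h : int) :
  0 <= h -> h <= N%:Z -> odd (absz h) = odd x ->
  #|[set y : 'I_N | ~~ odd (x + y)%N && ((y : nat)%:Z < h)]| = (absz h)./2.
Proof.
case: h => // k _; rewrite lez_nat absz_nat => kN par.
rewrite -sum1dep_card.
rewrite -(big_ord_widen_cond _ (fun y => ~~ odd (x + y)%N) (fun=> 1%N) kN) big_mkcond.
transitivity (\sum_(y < k) ~~ odd (x + y))%N.
  by apply: eq_bigr => y _; case: (odd _).
by rewrite sum_even_shift -par; case: ifP; lia.
Qed.

Lemma area_area_from n p : size p = (2 * n)%N -> is_dyck n p ->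
  area n p = area_from 0 p.
Proof.
move=> sp dp; rewrite /area /area_from sp -sum1dep_card.
rewrite -(pair_big_dep xpredT (fun x y : 'I_(2 * n).+1 => ~~ odd (x + y)%N &&
  ((y : nat)%:Z < height p x)) (fun _ _ => 1%N)) /=.
apply: eq_bigr => x _; have xn : (x <= 2 * n)%N by rewrite -ltnS.
rewrite sum1dep_card add0r; apply: card_same_parity_below.
- exact: (dyck_height_ge0 dp xn).
- by have := dyck_height_le sp dp xn; lia.
by have := dyck_height_ge0 dp xn; rewrite height_count ?sp //; lia.
Qed.

(** * Path conditions by recursion on the steps, from any starting height *)

Fixpoint dyck_from (h : int) (p : seq bool) : bool :=
  (0 <= h) && if p is b :: p' then dyck_from (h + sgn b) p' else h == 0.

Definition msgn (s : mstep) : int :=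
  match s with MUp => 1 | MDown => -1 | MHor => 0 end.

Fixpoint motzkin_from (h : int) (m : seq mstep) : bool :=
  (1 <= h) && if m is s :: m' then motzkin_from (h + 2 * msgn s) m' else h == 1.

Lemma dyck_fromP h p :
  reflect (h + height p (size p) = 0 /\
           forall x, (x <= size p)%N -> 0 <= h + height p x)
    (dyck_from h p).
Proof.
elim: p h => [|b p IH] h /=.
  rewrite height0 addr0; apply: (iffP andP) => [[h0 /eqP h1]|[h1 H]].
    by split=> // x _; rewrite /height /= subrr addr0.
  by rewrite h1.
rewrite height_cons addrA; apply: (iffP andP) => [[h0 /IH[he H]]|[he H]].
  split=> // -[|x] xp; first by rewrite height0 addr0.
  by rewrite height_cons addrA; apply: H.
split; first by have := H 0%N; rewrite height0 addr0; apply.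
apply/IH; split=> // x xp.
by have := H x.+1; rewrite height_cons addrA; apply.
Qed.

Lemma is_dyckE n p : size p = (2 * n)%N -> is_dyck n p = dyck_from 0 p.
Proof.
move=> sp; apply/and3P/dyck_fromP.
  move=> [/eqP pu /eqP pd /forallP H]; split.
    by rewrite /height take_size pu pd; lia.
  move=> x; rewrite sp => xn; rewrite add0r.
  by have := H (inord x); rewrite inordK // ltnS.
rewrite {1}/height take_size => -[e H].
have := count_predC id p; rewrite -[count (predC _) _]/(count negb _) sp => cp.
split; [by apply/eqP; lia | by apply/eqP; lia |].
apply/forallP => x; have := H x; rewrite add0r; apply.
by rewrite sp -ltnS.
Qed.

Lemma mheight0 m : mheight m 0 = 1.
Proof. by rewrite /mheight take0 /=; lia. Qed.

Lemma mheight_cons s m k :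
  mheight (s :: m) k.+1 = 2 * msgn s + mheight m k.
Proof. by rewrite /mheight /=; case: s => /=; lia. Qed.

(* [mheight] starts at 1 and [motzkin_from h] at h: the ordinates are
   h - 1 + mheight m k, and the bound 1 becomes 2. *)
Lemma motzkin_fromP h m :
  reflect (h + mheight m (size m) = 2 /\
           forall k, (k <= size m)%N -> 2 <= h + mheight m k)
    (motzkin_from h m).
Proof.
elim: m h => [|s m IH] h /=.
  rewrite mheight0; apply: (iffP andP) => [[h0 /eqP h1]|[h1 H]].
    by split=> [|x _]; rewrite h1 // /mheight.
  by split; lia.
rewrite mheight_cons addrA; apply: (iffP andP) => [[h0 /IH[he H]]|[he H]].
  split=> // -[|x] xp; first by rewrite mheight0; lia.
  by rewrite mheight_cons addrA; apply: H.
split; first by have := H 0%N isT; rewrite mheight0; lia.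
apply/IH; split=> // x xp.
by have := H x.+1; rewrite mheight_cons addrA; apply.
Qed.

Lemma is_motzkinE m : is_motzkin m = motzkin_from 1 m.
Proof.
apply/andP/motzkin_fromP => [[/eqP e /forallP H]|[e H]].
  split=> [|k km]; first by rewrite e.
  by have := H (inord k); rewrite inordK ?ltnS //; lia.
split; first by apply/eqP; lia.
by apply/forallP => k; have := H k; rewrite -ltnS ltn_ord; lia.
Qed.

(** * Comparison of a path of pairs with its Motzkin path *)

Lemma odd_levelE (k : int) :
  (2 * k + 1 + 1 + 1 = 2 * (k + 1) + 1)
 * (2 * k + 1 + 1 - 1 = 2 * k + 1)
 * (2 * k + 1 - 1 + 1 = 2 * k + 1)
 * (2 * k + 1 - 1 - 1 = 2 * (k - 1) + 1)
 * (2 * k + 1 + 2 * 1 = 2 * (k + 1) + 1)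
 * (2 * k + 1 + 2 * - 1 = 2 * (k - 1) + 1)
 * (2 * k + 1 + 2 * 0 = 2 * k + 1).
Proof. by do !split; lia. Qed.

(** At the ends of pairs the height is odd, so being nonnegative means being at least 1; the
    midpoints, one unit away, are then nonnegative too. *)
Lemma dyck_from_unpair (k : int) w :
  dyck_from (2 * k + 1) (unpair w ++ [:: false]) =
  motzkin_from (2 * k + 1) (map mproj w).
Proof.
elim: w k => [|[a b] w IH] k /=; first by rewrite /sgn; lia.
(* [odd_levelE] brings the height after a pair back to the form 2k + 1 required by [IH]. *)
by case: a; case: b; rewrite /= /sgn ?odd_levelE IH;
  case: motzkin_from; rewrite ?andbT ?andbF //; lia.
Qed.

Lemma path_of_dyck w :
  is_dyck (size w).+1 (path_of w) = is_motzkin (map mproj w).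
Proof.
rewrite is_dyckE ?size_path_of // is_motzkinE /path_of /=.
exact: (dyck_from_unpair 0 w).
Qed.

(** UD and DU have the same ends; their midpoints are at heights 2k + 2 and 2k, so each UD adds one
    point. *)
Lemma area_from_unpair (k : int) w : motzkin_from (2 * k + 1) (map mproj w) ->
  area_from (2 * k + 1) (unpair w ++ [:: false]) =
  (area_from (2 * k + 1) (unpair (map mlift (map mproj w)) ++ [:: false])
   + count_mem (true, false) w)%N.
Proof.
elim: w k => [|[a b] w IH] k /=; first by rewrite addn0.
case/andP=> k0 H.
rewrite !area_from_cons -!addnA; congr addn.
case: a H; case: b; rewrite /= /sgn ?odd_levelE => /IH ->;
  rewrite ?add0n //.
have -> : ((absz (2 * k + 1 + 1)%R)./2 = (absz (2 * k + 1 - 1)%R)./2.+1)%N by lia.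
by rewrite add1n !addnS.
Qed.

Lemma path_of_pairup n p : size p = (2 * n.+1)%N -> is_dyck n.+1 p ->
  path_of (pairup (behead p)) = p.
Proof.
move=> sp dp; have H := dyck_height_ge0 dp; have He := dyck_height_end sp dp.
case: p sp dp H He => [//|a s] /= sp dp H He.
have ss : size s = (2 * n).+1 by lia.
have [_ es] := pairupK ss.
have Ha : a = true.
  have := H 1%N; rewrite height_cons height0 /sgn addr0; case: (a) => //.
  by move=> /(_ isT).
have Hl : last false s = false.
  (* The last step goes from a nonnegative height to 0, so it is not an up step. *)
  have := H (2 * n).+1; move: He; rewrite {1}mulnS add2n.
  rewrite (@heightS (a :: s) (2 * n).+1) /= ?ss //.
  rewrite -nth_last ss /= /sgn; case: (nth _ _ _) => // e h.
  have /h : ((2 * n).+1 <= 2 * n.+1)%N by lia.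
  by lia.
by rewrite Ha es Hl unpairK.
Qed.

(** The step leaving abscissa 2i + 1 is the first of pair [i], or the final down step when i is
    [size w]. *)
Lemma card_up_odd w :
  #|[set i : 'I_(size w).+1 | nth false (path_of w) (2 * i).+1]| =
  count fst w.
Proof.
rewrite /= (@card_ord_sum _ (fun i => nth false (unpair w ++ [:: false]) (2 * i))).
elim: w => [|[a b] w IH]; first by rewrite big_ord_recl big_ord0.
rewrite [size _]/= big_ord_recl [RHS]/= -IH; congr addn.
by apply: eq_bigr => i _; rewrite lift0 mulnS.
Qed.

Lemma area_path_of w : is_motzkin (map mproj w) ->
  area (size w).+1 (path_of w) =
  (marea (size w).+1 (map mproj w) + count_mem (true, false) w)%N.
Proof.
move=> mw; rewrite /marea rhoE.
have sw : size (map mlift (map mproj w)) = size w by rewrite !size_map.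
have dw : is_dyck (size w).+1 (path_of (map mlift (map mproj w))).
  by rewrite -{1}sw path_of_dyck (mapK mliftK).
rewrite !area_area_from ?size_path_of ?sw ?path_of_dyck //.
rewrite /path_of !area_from_cons -addnA; congr addn.
by apply: (@area_from_unpair 0); rewrite -is_motzkinE.
Qed.

Lemma rk_path_of w : is_motzkin (map mproj w) ->
  rk (size w).+1 (path_of w) = count fst w.
Proof.
by move=> mw; rewrite rk_count ?size_path_of ?path_of_dyck // card_up_odd.
Qed.

Lemma mrk_count_up m : is_motzkin m ->
  mrk (size m).+1 m = count_mem MUp m.
Proof.
move=> mm; rewrite /mrk rhoE.
have sm : size (map mlift m) = size m by rewrite size_map.
rewrite -{1}sm rk_path_of ?(mapK mliftK) // count_map.
by apply: eq_count => -[].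
Qed.

Lemma count_fst_mproj w :
  count fst w = (count_mem MUp (map mproj w) + count_mem (true, false) w)%N.
Proof. by elim: w => //= -[[] []] w ->; rewrite /= ?add0n ?addnS ?add1n. Qed.

(** * Summation over the lifts of a Motzkin path *)

Lemma motzkin_count_hor m : is_motzkin m ->
  count_mem MHor m = (size m - 2 * count_mem MUp m)%N.
Proof.
case/andP=> /eqP; rewrite /mheight take_size => e _.
have -> : size m = (count_mem MUp m + count_mem MDown m + count_mem MHor m)%N.
  by elim: m {e} => //= -[] m -> /=; lia.
by lia.
Qed.

(** Passes to finite functions, over which products of sums are expanded. *)
Lemma big_tuple_ffun (R : nmodType) (T : finType) k
    (P : pred (k.-tuple T)) (F : k.-tuple T -> R) :
  \sum_(w | P w) F w =
  \sum_(f : {ffun 'I_k -> T} | P [tuple f i | i < k]) F [tuple f i | i < k].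
Proof.
apply: (reindex (fun f : {ffun 'I_k -> T} => [tuple f i | i < k])).
exists (fun w : k.-tuple T => [ffun i => tnth w i]) => [f _ | w _].
  by apply/ffunP => i; rewrite ffunE tnth_mktuple.
by apply: eq_from_tnth => i; rewrite tnth_mktuple ffunE.
Qed.

(** Lifts are chosen step by step: a horizontal step has the lifts DU and UD, of weights 1 and [c],
    any other step a single lift of weight 1. *)
Lemma sum_mproj_fiber (R : comNzRingType) (c : R) k (m : k.-tuple mstep) :
  \sum_(w : k.-tuple (bool * bool) | map_tuple mproj w == m)
    c ^+ count_mem (true, false) w = (1 + c) ^+ count_mem MHor m.
Proof.
(* Vanishing off the fibre lets the sum run over all words, so that it factors. *)
pose F (i : 'I_k) ab := if mproj ab == tnth m i then c ^+ (ab == (true, false)) else 0.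
have expr_count (T : eqType) (a : T) (x : R) (w : k.-tuple T) :
    x ^+ count_mem a w = \prod_(i < k) x ^+ (tnth w i == a).
  rewrite -(big_tuple _ _ w xpredT (fun y => x ^+ (y == a))) /=.
  by elim: (tval w) => [|y s IH]; rewrite ?big_nil ?big_cons //= exprD IH.
transitivity (\prod_(i < k) \sum_ab F i ab).
  rewrite bigA_distr_bigA big_tuple_ffun big_mkcond; apply: eq_bigr => f _.
  have [e|ne] := ifPn.
    rewrite expr_count; apply: eq_bigr => i _.
    by rewrite tnth_mktuple /F -(eqP e) tnth_map tnth_mktuple eqxx.
  have [i nei] : exists i, mproj (f i) != tnth m i.
    apply/existsP; apply: contraR ne => /existsPn H; apply/eqP.
    apply: eq_from_tnth => i; rewrite tnth_map tnth_mktuple.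
    by apply/eqP; rewrite -[_ == _]negbK H.
  by rewrite (bigD1 i) //= /F (negbTE nei) mul0r.
rewrite expr_count; apply: eq_bigr => i _.
rewrite (eq_bigr (fun ab => F i (ab.1, ab.2))) => [|[] //].
rewrite -(pair_bigA _ (fun a b => F i (a, b))) /= !big_bool /F.
by case: (tnth m i); rewrite /= ?expr0 ?expr1 ?add0r ?addr0 // addrC.
Qed.

Theorem mainTheorem2 (n : nat) (n_ge1 : (1 <= n)%N)
    (R : comNzRingType) (q t : R) :
  \sum_(p in Dyck n) q ^+ area n p * t ^+ rk n p =
  \sum_(m in Motzkin n)
    q ^+ marea n m * t ^+ mrk n m * (1 + q * t) ^+ (n - 1 - 2 * mrk n m)%N.
Proof.
case: n n_ge1 => [//|n] _.
have enc_size (w : n.-tuple (bool * bool)) : size (path_of w) == (2 * n.+1)%N.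
  by rewrite size_path_of size_tuple.
have dec_size (p : (2 * n.+1).-tuple bool) : size (pairup (behead p)) == n.
  have sp : size (behead p) = (2 * n).+1 by rewrite size_behead size_tuple mulnS.
  by have [-> _] := pairupK sp.
(* Dyck paths are reindexed by words of pairs, through [path_of] and its inverse. *)
rewrite (reindex_onto (fun w => Tuple (enc_size w)) (fun p => Tuple (dec_size p))) /=;
  last first.
  move=> p; rewrite inE => dp; apply: val_inj => /=.
  by apply: (path_of_pairup _ dp); rewrite size_tuple.
rewrite (eq_bigl (fun w : n.-tuple _ => map_tuple mproj w \in Motzkin n.+1)); last first.
  move=> w; rewrite !inE /= -{1}(size_tuple w) path_of_dyck.
  by rewrite -val_eqE /= unpairK // eqxx andbT.
rewrite (partition_big (fun w : n.-tuple _ => map_tuple mproj w)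
  (fun m => m \in Motzkin n.+1)) //=.
apply: eq_bigr => m; rewrite inE => mm.
have -> : (n.+1 - 1 - 2 * mrk n.+1 m = count_mem MHor m)%N.
  have := mrk_count_up mm; have := motzkin_count_hor mm.
  by rewrite size_tuple => -> ->; rewrite subn1.
(* Here [c] is [q * t]: each UD adds one to both area and rank. *)
rewrite -sum_mproj_fiber mulr_sumr; apply: eq_big => [w|w /andP[_ /eqP em]].
  by rewrite inE; case: eqP => [->|]; rewrite ?andbF // mm.
have em' : map mproj w = m by rewrite -em.
have mw : is_motzkin (map mproj w) by rewrite em'.
have := area_path_of mw; have := rk_path_of mw; have := mrk_count_up mm.
rewrite !size_tuple em' => -> -> ->; rewrite count_fst_mproj em'.
by rewrite !exprD exprMn mulrACA.
Qed.
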